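(* (1) For any $\epsilon>0$ and $u_0\in\mathbb{R}$, there exists $E\subseteq\mathbb{Z}^2$ such that for all $v\in(-\epsilon,\epsilon)$, \[\overline{D}(E\cap t_{u_0,v})=D(E\cap t_{u_0,v})=D(E)=\overline{D}(E)=1.\] (2) For any $\epsilon>0$ and $u_0\in\mathbb{R}$, there exists $E\subseteq\mathbb{Z}^2$ such that for all $v\in(-\epsilon,\epsilon)$, \[D(E\cap t_{u_0,v})=D(E)=1\quad\text{and}\quad \overline{D}(E\cap t_{u_0,v})=\overline{D}(E)=0.\]
   Context: For a $1$-separated set $E\subset\mathbb{R}^2$ (in particular for any $E\subseteq\mathbb{Z}^2$), the mass dimension $\overline{D}(E)$ and the counting dimension $D(E)$ are \[\overline{D}(E)=\limsup_{l\to\infty}\frac{\log|E\cap[-l,l]^2|}{\log(2l)},\qquad D(E)=\limsup_{\|C\|\to\infty}\frac{\log|E\cap C|}{\log\|C\|},\] where $C\subset\mathbb{R}^2$ ranges over arbitrary squares (placed anywhere in the plane) with sides parallel to the coordinate axes, $\|C\|$ is the side length of $C$, and the second limsup means $\lim_{R\to\infty}\sup_{\|C\|\ge R}$. For $u,v\in\mathbb{R}$ with $u\neq0$, the width-1 tube $t_{u,v}$ is \[t_{u,v}=\Big\{(x,y)\in\mathbb{R}^2 : -\tfrac1u x+v\sqrt{1+\tfrac1{u^2}}<y\le-\tfrac1u x+(v+1)\sqrt{1+\tfrac1{u^2}}\Big\}.\] The line through the origin perpendicular to it has slope $u$. For $u=0$, $t_{0,v}=\{(x,y)\in\mathbb{R}^2: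 v<x\le v+1\}$ (vertical tube). *)

(* Defs.v *)
From HB Require Import structures.
From mathcomp Require Import all_boot all_order all_algebra.
From mathcomp Require Import all_classical all_reals all_analysis.
Set Implicit Arguments.
Unset Strict Implicit.
Unset Printing Implicit Defensive.
Import Order.TTheory GRing.Theory Num.Theory.
Import numFieldNormedType.Exports.
Local Open Scope classical_set_scope.
Local Open Scope ring_scope.

Definition integer_lattice (R : realType) : set (R * R) :=
  [set p | p.1 \is a Num.int /\ p.2 \is a Num.int].

Definition square (R : realType) (a b s : R) : set (R * R) :=
  [set` `[a, a + s]] `*` [set` `[b, b + s]].

(* [counting A] is +oo for infinite A, and [lne 0 = -oo], so that the quotient
   is -oo when A is empty and 1 < s. *)
Definition log_ratio (R : realType) (A : set (R * R)) (s : R) : \bar R :=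
  (lne (counting A) / (ln s)%:E)%E.

Definition mass_dim (R : realType) (E : set (R * R)) : \bar R :=
  limf_esup
    (fun l : R => log_ratio (E `&` ([set` `[- l, l]] `*` [set` `[- l, l]])) (2 * l))
    +oo%R.

(* The limit exists because the supremum is nonincreasing in r.  A square is
   given by its lower left corner (c.1.1, c.1.2) and its side length c.2; the
   degenerate case c.2 <= 0 is only met for r <= 0. *)
Definition counting_dim (R : realType) (E : set (R * R)) : \bar R :=
  lim ((fun r : R => ereal_sup
          [set log_ratio (E `&` square c.1.1 c.1.2 c.2) c.2
          | c in [set c : R * R * R | r <= c.2]]) @ +oo%R).

Definition tube (R : realType) (u v : R) : set (R * R) :=
  if u == 0 then [set p | v < p.1 <= v + 1]
  else [set p | - (1 / u) * p.1 + v * Num.sqrt (1 + 1 / u ^+ 2) < p.2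
                <= - (1 / u) * p.1 + (v + 1) * Num.sqrt (1 + 1 / u ^+ 2)].

(* Main.v *)
(* The tube t_{u,v} with u <> 0 consists of the points (x, y) such that y + x/u
   lies in a half-open interval of length sqrt (1 + 1/u^2) >= 1, so above every
   integer x it contains at least one and at most boundedly many lattice points;
   for u = 0 exchange the axes.  Let E be the lattice points of the union of the
   tubes with |v| < eps whose long coordinate lies in a fixed set S: both E and
   its intersections with these tubes have that shape, and their dimensions only
   depend on S.  A square of side s meets O(s) lattice lines, so all dimensions
   are at most 1.  For (1) let S consist of all naturals.  For (2) let S be the
   union of the blocks [2^k, 2^k + k]: it contains arbitrarily long runs, so the
   counting dimension stays 1, but only O((ln l)^2) elements up to l, so the mass
   dimension is 0. *)
Require Import Defs.
From mathcomp Require Import all_boot all_order all_algebra finmap ring lra.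
From mathcomp Require Import all_classical all_reals all_analysis.
Set Implicit Arguments.
Unset Strict Implicit.
Unset Printing Implicit Defensive.
Import Order.TTheory GRing.Theory Num.Theory.
Local Open Scope classical_set_scope.
Local Open Scope ring_scope.

(** * Cardinality bounds from lists *)

Lemma counting_le_size (R : realType) (T : choiceType) (A : set T) (s : seq T) :
  A `<=` [set` s] -> (counting A <= (size s)%:R%:E :> \bar R)%E.
Proof.
move=> As; have fs : finite_set [set` s].
  by apply: sub_finite_set (finite_fset [fset x in s]%fset) => x; rewrite /= inE.
have fA : finite_set A by apply: sub_finite_set fs.
rewrite /counting asboolT// lee_fin ler_nat.
apply: (@leq_trans #|` [fset x in s]%fset|); last by rewrite card_fseq size_undup.
apply/fsubset_leq_card/fsubsetP => x; rewrite in_fset_set// inE => Ax.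
by rewrite inE; exact: As Ax.
Qed.

Lemma counting_ge_size (R : realType) (T : choiceType) (A : set T) (s : seq T) :
  uniq s -> [set` s] `<=` A -> ((size s)%:R%:E <= counting A :> \bar R)%E.
Proof.
move=> us sA; rewrite /counting; case: asboolP => fA; last by rewrite leey.
rewrite lee_fin ler_nat -(undup_id us) -card_fseq.
apply/fsubset_leq_card/fsubsetP => x; rewrite !inE => xs.
by rewrite in_fset_set// inE; exact: sA.
Qed.

(** * From point counts to dimensions *)

Section LogRatio.
Variable R : realType.
Implicit Types (A E : set (R * R)) (s N c e r : R).

Lemma log_ratio_le A s N : 1 < s -> 0 < N -> (counting A <= N%:E)%E ->
  (log_ratio A s <= (ln N / ln s)%:E)%E.
Proof.
move=> s1 N0 AN; have ls0 := ln_gt0 s1.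
rewrite /log_ratio inver gt_eqF// EFinM.
apply: lee_wpmul2r; first by rewrite lee_fin invr_ge0 ltW.
by rewrite -lne_EFin// lee_lne// in_itv/= leey andbT ?lee_fin ?(ltW N0)//.
Qed.

Lemma log_ratio_ge A s N : 1 < s -> 0 < N -> (N%:E <= counting A)%E ->
  ((ln N / ln s)%:E <= log_ratio A s)%E.
Proof.
move=> s1 N0 AN; have ls0 := ln_gt0 s1.
rewrite /log_ratio inver gt_eqF// EFinM.
apply: lee_wpmul2r; first by rewrite lee_fin invr_ge0 ltW.
by rewrite -lne_EFin// lee_lne// in_itv/= leey andbT ?lee_fin ?(ltW N0)//.
Qed.

(** Since [ln (c * s) / ln s - 1 = ln c / ln s], a constant factor in a count disappears in the
    limit. *)
Lemma ln_linear_ratio c e : 0 < c -> 0 < e ->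
  exists2 r, 1 < r & forall s, r <= s -> `|ln (c * s) / ln s - 1| <= e.
Proof.
move=> c0 e0; exists (expR (1 + `|ln c| / e)).
  by rewrite expR_gt1; apply: ltr_wpDr => //; rewrite divr_ge0// ltW.
move=> s rs; have s0 : 0 < s by apply: lt_le_trans rs; exact: expR_gt0.
have lns : 1 + `|ln c| / e <= ln s.
  by rewrite -ler_expR lnK ?posrE.
have lns0 : 0 < ln s.
  by apply: lt_le_trans lns; apply: ltr_wpDr => //; rewrite divr_ge0// ltW.
rewrite lnM ?posrE// mulrDl divff ?gt_eqF// addrK normrM normfV (gtr0_norm lns0).
rewrite ler_pdivrMr// mulrC -ler_pdivrMr//; apply: le_trans lns.
by rewrite lerDr.
Qed.

(* [c t^2 <= (e t / 3)^3 <= (expR (e t / 3))^3] for large [t = ln s]. *)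
Lemma ln_polylog_ratio c e : 0 < c -> 0 < e ->
  exists2 r, 1 < r & forall s, r <= s -> ln (c * ln s ^+ 2) / ln s <= e.
Proof.
(* [B] is the value of [t] from which [c * t ^+ 2 <= (e / 3 * t) ^+ 3] holds. *)
move=> c0 e0; set B := c / (e / 3) ^+ 3.
have B0 : 0 < B by rewrite divr_gt0// exprn_gt0// divr_gt0.
exists (expR (1 + B)); first by rewrite expR_gt1 addr_gt0.
move=> s rs; have s0 : 0 < s by apply: lt_le_trans rs; exact: expR_gt0.
have lns : 1 + B <= ln s by rewrite -ler_expR lnK ?posrE.
set t := ln s in lns *; have t0 : 0 < t by apply: lt_le_trans lns; rewrite addr_gt0.
rewrite ler_pdivrMr// -ler_expR lnK ?posrE ?mulr_gt0 ?exprn_gt0//.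
have -> : e * t = e / 3 * t * 3%:R by field.
rewrite expRM_natr.
apply: (@le_trans _ _ ((e / 3 * t) ^+ 3)).
  have -> : (e / 3 * t) ^+ 3 = (e / 3) ^+ 3 * t * t ^+ 2 by ring.
  apply: ler_wpM2r; first by rewrite exprn_ge0 ?ltW.
  rewrite mulrC -ler_pdivrMr ?exprn_gt0 ?divr_gt0//.
  by apply: le_trans lns; rewrite lerDr.
rewrite lerXn2r ?nnegrE ?expR_ge0 ?mulr_ge0 ?divr_ge0 ?(ltW t0) ?(ltW e0)//.
by apply: le_trans (expR_ge1Dx _); rewrite lerDr.
Qed.

(** The suprema do not increase with [r], so the limit is an infimum and bounds can be checked at
    one [r] at a time. *)
Lemma counting_dimE E : counting_dim E =
  ereal_inf (range (fun r : R => ereal_sup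
    [set log_ratio (E `&` square c.1.1 c.1.2 c.2) c.2
    | c in [set c : R * R * R | r <= c.2]])).
Proof.
apply/cvg_lim; first exact: ereal_hausdorff.
apply: nonincreasing_cvge => m n mn.
apply: ereal_sup_le => _ [c /= nc <-]; exists c => //=; exact: le_trans nc.
Qed.

Lemma counting_dim_le E (y : \bar R) :
  (forall e, 0 < e -> exists r, forall a b s, r <= s ->
    (log_ratio (E `&` square a b s) s <= y + e%:E)%E) ->
  (counting_dim E <= y)%E.
Proof.
move=> H; rewrite counting_dimE; apply/lee_addgt0Pr => e /H[r Hr].
apply: ge_ereal_inf; eexists; first by exists r.
by apply/ereal_supP => _ [c /= rc <-]; exact: Hr.
Qed.

Lemma counting_dim_ge E (y : \bar R) :
  (forall e r, 0 < e -> exists a b s, r <= s /\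
    (y <= log_ratio (E `&` square a b s) s + e%:E)%E) ->
  (y <= counting_dim E)%E.
Proof.
move=> H; rewrite counting_dimE; apply/ereal_infP => _ [r _ <-].
apply/lee_addgt0Pr => e /(H e r)[a [b [s [rs Hs]]]].
apply: le_trans Hs _; apply: leeD => //.
by apply: ereal_sup_ubound; exists (a, b, s).
Qed.

(** The window is written as a [square] of side [2 * l], so that one counting bound serves both
    dimensions. *)
Lemma mass_dim_le E (y : \bar R) :
  (forall e, 0 < e -> exists r, forall l, r <= l ->
    (log_ratio (E `&` square (- l) (- l) (2 * l)) (2 * l) <= y + e%:E)%E) ->
  (mass_dim E <= y)%E.
Proof.
move=> H; apply/lee_addgt0Pr => e /H[r Hr].
apply: ge_ereal_inf; eexists.
  exists [set l | r < l] => //.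
  by exists r; split => //; exact: num_real.
apply/ereal_supP => _ [l /= rl <-].
by have := Hr l (ltW rl); rewrite /square (_ : - l + 2 * l = l)//; ring.
Qed.

Lemma mass_dim_ge E (y : \bar R) :
  (forall e r, 0 < e -> exists2 l, r <= l &
    (y <= log_ratio (E `&` square (- l) (- l) (2 * l)) (2 * l) + e%:E)%E) ->
  (y <= mass_dim E)%E.
Proof.
move=> H; apply/ereal_infP => _ [V [M [_ MV]] <-].
apply/lee_addgt0Pr => e /(H e (M + 1))[l Ml Hl].
apply: le_trans Hl _; apply: leeD => //.
apply: ereal_sup_ubound; exists l; first by apply: MV; lra.
by rewrite /square (_ : - l + 2 * l = l)//; ring.
Qed.

Lemma dims_le1 E c : 0 < c ->
  (forall a b s, 1 < s -> (counting (E `&` square a b s) <= (c * s)%:E)%E) ->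
  (counting_dim E <= 1)%E /\ (mass_dim E <= 1)%E.
Proof.
move=> c0 H.
have {}H e : 0 < e -> exists2 r, 1 < r & forall a b s, r <= s ->
    (log_ratio (E `&` square a b s) s <= 1 + e%:E)%E.
  move=> /(ln_linear_ratio c0)[r r1 Hr]; exists r => // a b s rs.
  have s1 := lt_le_trans r1 rs.
  apply: le_trans (log_ratio_le s1 _ (H _ _ _ s1)) _.
    by rewrite mulr_gt0// (lt_trans _ s1).
  by rewrite -EFinD lee_fin; have := Hr s rs; rewrite ler_norml; lra.
split.
  by apply: counting_dim_le => e /H[r r1 Hr]; exists r.
apply: mass_dim_le => e /H[r r1 Hr]; exists r => l rl.
by apply: Hr; lra.
Qed.

(** The squares may move as they grow, which is what lets a sparse set with long runs reach
    dimension 1. *)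
Lemma counting_dim_ge1 E c : 0 < c ->
  (forall r, exists a b s, r <= s /\
    ((c * s)%:E <= counting (E `&` square a b s))%E) ->
  (1 <= counting_dim E)%E.
Proof.
move=> c0 H; apply: counting_dim_ge => e r /(ln_linear_ratio c0)[r' r1 Hr].
have [a [b [s []]]] := H (Num.max r r'); rewrite ge_max => /andP[rs rs'] Hs.
exists a, b, s; split => //; have s1 := lt_le_trans r1 rs'.
have cs0 : 0 < c * s by rewrite mulr_gt0// (lt_trans _ s1).
apply: le_trans (leeD (log_ratio_ge s1 cs0 Hs) (lexx _)).
by rewrite -EFinD lee_fin; have := Hr s rs'; rewrite ler_norml; lra.
Qed.

Lemma mass_dim_ge1 E c : 0 < c ->
  (forall r, exists2 l, r <= l &
    ((c * l)%:E <= counting (E `&` square (- l) (- l) (2 * l)))%E) ->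
  (1 <= mass_dim E)%E.
Proof.
move=> c0 H; apply: mass_dim_ge => e r e0.
(* The window has side [2 * l], and [c * l = c / 2 * (2 * l)]. *)
have [||r' r1 Hr] := @ln_linear_ratio (c / 2) e; rewrite ?divr_gt0//.
have [l] := H (Num.max r r'); rewrite ge_max => /andP[rl rl'] Hl.
exists l => //; have l1 : 1 < 2 * l by lra.
have cl0 : 0 < c * l by rewrite mulr_gt0//; lra.
apply: le_trans (leeD (log_ratio_ge l1 cl0 Hl) (lexx _)).
rewrite -EFinD lee_fin; have := Hr (2 * l); rewrite ler_norml.
by rewrite (_ : c / 2 * (2 * l) = c * l); [lra | field].
Qed.

(** The upper bound is [ln_polylog_ratio]. For the lower one, a window meeting [E] has ratio at
    least [ln 1 / ln (2 * l) = 0], whereas an empty one would give -oo. *)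
Lemma mass_dim_eq0 E c : 0 < c -> E !=set0 ->
  (forall l, 1 < l -> (counting (E `&` square (- l) (- l) (2 * l)) <=
    (c * ln (2 * l) ^+ 2)%:E)%E) ->
  mass_dim E = 0%E.
Proof.
move=> c0 [p Ep] H; apply/eqP; rewrite eq_le; apply/andP; split.
  apply: mass_dim_le => e /(ln_polylog_ratio c0)[r r1 Hr].
  exists r => l rl; have l1 : 1 < l by exact: lt_le_trans rl.
  have l2 : 1 < 2 * l by lra.
  apply: le_trans (log_ratio_le l2 _ (H l l1)) _.
    by rewrite mulr_gt0// exprn_gt0// ln_gt0.
  by rewrite add0e lee_fin Hr//; lra.
(* Large enough that [r <= l] and the window contains [p]. *)
apply: mass_dim_ge => e r e0; exists (1 + `|r| + `|p.1| + `|p.2|).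
  by have := ler_norm r; have := normr_ge0 p.1; have := normr_ge0 p.2; lra.
set l := 1 + _ + _ + _; have l1 : 1 <= l by rewrite /l -!addrA lerDl !addr_ge0.
have : (0 <= log_ratio (E `&` square (- l) (- l) (2 * l)) (2 * l))%E.
  rewrite (_ : 0%E = (ln 1 / ln (2 * l))%:E :> \bar R); last by rewrite ln1 mul0r.
  apply: log_ratio_ge => //; first by lra.
  rewrite (_ : 1%:E = (size [:: p])%:R%:E)//; apply: counting_ge_size => //.
  move=> q; rewrite /= inE => /eqP->; split => //; split; rewrite /= in_itv /=.
    by apply/andP; split; have := ler_norm p.1; have := ler_norm (- p.1);
      rewrite normrN /l; have := normr_ge0 r; have := normr_ge0 p.2; lra.
  by apply/andP; split; have := ler_norm p.2; have := ler_norm (- p.2);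
    rewrite normrN /l; have := normr_ge0 r; have := normr_ge0 p.1; lra.
by move=> h; rewrite adde_ge0// lee_fin ltW.
Qed.

End LogRatio.

(** * Lattice points in slanted strips *)

Lemma int_itv_offset (R : realType) (x a s : R) (k : nat) :
  x \is a Num.int -> a <= x <= a + s -> s <= k%:R ->
  exists2 i : nat, (i < k.+2)%N & x = (Num.floor a)%:~R + i%:R.
Proof.
move=> /intrP[z ->{x}] /andP[az zs] sk.
have /andP[fa af] := floor_itv a.
have zf : (Num.floor a <= z)%R by rewrite -[leRHS](@intrKfloor R); apply: le_floor.
exists `|z - Num.floor a|%N; last first.
  by rewrite natr_absz ger0_norm ?subr_ge0// intrB; ring.
rewrite -ltz_nat gez0_abs ?subr_ge0// -(ltr_int R) intrB.
have : (k.+2%:Z%:~R : R) = k%:R + 2 by rewrite -pmulrn -addn2 natrD.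
move=> ->; rewrite intrD in af; lra.
Qed.

Section Slanted.
Variable R : realType.
Implicit Types (al lo hi s l : R) (S : set nat) (p : R * R) (b : bool).

(* [b = true] serves vertical tubes, which run along the second axis. *)
Definition longc b p := if b then p.2 else p.1.
Definition transc b p := if b then p.1 else p.2.
Definition mkpt b (x y : R) := if b then (y, x) else (x, y).

Lemma longc_mkpt b x y : longc b (mkpt b x y) = x. Proof. by case: b. Qed.
Lemma transc_mkpt b x y : transc b (mkpt b x y) = y. Proof. by case: b. Qed.
Lemma mkptK b p : mkpt b (longc b p) (transc b p) = p.
Proof. by case: b; case: p. Qed.

(** The common shape of [E] and of its intersections with tubes: only [lo] and [hi] differ between
    them. *)
Definition slanted b al lo hi S : set (R * R) := [set p |
  [/\ exists2 n, S n & longc b p = n%:R, transc b p \is a Num.int &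
      lo < transc b p + al * longc b p <= hi]].

Lemma slanted_int b al lo hi S : slanted b al lo hi S `<=` @integer_lattice R.
Proof. by case: b => p [/= [n _ pn] pi _]; split => //; rewrite pn intr_nat. Qed.

(** Over a long coordinate [x], the other one is an integer in an interval of length at most [w]
    starting at [lo - al * x], which leaves [w + 2] candidates. *)
Lemma slanted_count_le b al lo hi S (A : set (R * R)) (ns : seq R) (w : nat) :
  hi - lo <= w%:R -> A `<=` slanted b al lo hi S ->
  (forall p, A p -> longc b p \in ns) ->
  (counting A <= (size ns * w.+2)%:R%:E :> \bar R)%E.
Proof.
move=> low AS Ans.
pose s := [seq mkpt b x ((Num.floor (lo - al * x))%:~R + i%:R)
  | x <- ns, i <- iota 0 w.+2].
rewrite (_ : (_ * _)%N = size s); last by rewrite size_allpairs size_iota.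
apply: counting_le_size => p Ap /=; apply/allpairsP.
have [_ pi /andP[plo phi]] := AS _ Ap.
have [|i iw pE] := int_itv_offset (a := lo - al * longc b p) pi _ low.
  by lra.
by exists (longc b p, i); split; rewrite ?Ans ?mem_iota//= -pE mkptK.
Qed.

Lemma slanted_square_le b al lo hi S : exists2 c, 0 < c &
  forall x y s, 1 < s ->
    (counting (slanted b al lo hi S `&` square x y s) <= (c * s)%:E)%E.
Proof.
pose w := Num.trunc `|hi - lo|.
have low : hi - lo <= w.+1%:R.
  apply: le_trans (ler_norm _) (ltW _).
  by have /andP[] := truncn_itv (normr_ge0 (hi - lo)).
(* The square meets at most [m + 3] lattice lines, where [m] is the integer part of [s], and
   [m + 3 <= 4 * s] because [1 < s]. *)
exists (4 * w.+3%:R); first by rewrite mulr_gt0.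
move=> x y s s1; have s0 : 0 <= s by lra.
pose m := Num.trunc s; have /andP[ms sm] := truncn_itv s0.
pose c := if b then y else x.
pose ns := [seq (Num.floor c)%:~R + i%:R : R | i <- iota 0 m.+3].
have H := @slanted_count_le b al lo hi S
  (slanted b al lo hi S `&` square x y s) ns w.+1 low.
apply: le_trans (H _ _) _; first exact: subIsetl.
- move=> p [[[n _ pn] _ _] []]; rewrite /= !in_itv /= => p1 p2.
  have [|||i im ->] := @int_itv_offset R (longc b p) c s m.+1.
  + by rewrite pn intr_nat.
  + by rewrite /longc /c; case: (b).
  + exact: ltW.
  + by apply/mapP; exists i => //; rewrite mem_iota.
rewrite lee_fin /ns size_map size_iota natrM.
rewrite [leRHS](_ : _ = (4 * s) * w.+3%:R); last by ring.
rewrite ler_wpM2r// (_ : m.+3 = (m + 3)%N); last by rewrite addn3.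
by rewrite natrD; rewrite -/m in ms; lra.
Qed.

(** The unit slice above [lo] holds a lattice point over each member of the run, and these points
    differ in their long coordinate. So [T] only has to contain that slice. *)
Lemma slanted_count_ge b al lo hi S (T : set (R * R)) (a m : nat) :
  lo + 1 <= hi -> (forall i, (i < m)%N -> S (a + i)%N) ->
  (forall n p, (a <= n < a + m)%N -> longc b p = n%:R ->
     lo < transc b p + al * n%:R <= lo + 1 -> T p) ->
  (m%:R%:E <= counting (slanted b al lo hi S `&` T) :> \bar R)%E.
Proof.
move=> lohi Sa HT.
(* Floor plus one is the least integer strictly above its argument, as the open lower end
   demands. *)
pose f i := mkpt b (a + i)%:R (Num.floor (lo - al * (a + i)%:R) + 1)%:~R.
rewrite -(size_iota 0 m) -(size_map f); apply: counting_ge_size.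
  rewrite map_inj_uniq ?iota_uniq// => i j /(congr1 (longc b)).
  by rewrite !longc_mkpt => /eqP; rewrite eqr_nat eqn_add2l => /eqP.
move=> p /= /mapP[i]; rewrite mem_iota add0n => /= im -> {p}.
have /andP[fl lf] := floor_itv (lo - al * (a + i)%:R).
have F : lo < transc b (f i) + al * (a + i)%:R <= lo + 1.
  by rewrite transc_mkpt intrD in lf *; lra.
split; last by apply: (HT (a + i)%N) => //; rewrite ?longc_mkpt// leq_addr ltn_add2l.
split; first by exists (a + i)%N; [exact: Sa | rewrite longc_mkpt].
- by rewrite transc_mkpt intr_int.
- by rewrite longc_mkpt; lra.
Qed.

Lemma slanted_counting_dim b al lo hi S : lo + 1 <= hi ->
  (forall m, exists a, forall i, (i < m)%N -> S (a + i)%N) ->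
  counting_dim (slanted b al lo hi S) = 1%E.
Proof.
move=> lohi HS; have [c c0 Hc] := slanted_square_le b al lo hi S.
apply/eqP; rewrite eq_le (dims_le1 c0 Hc).1/=.
(* Along a run of length [m] the strip drifts by at most [|al| * m] either way; the remaining [m]
   covers the run and the unit slice. *)
pose D : R := 2 * `|al| + 1; have al0 := normr_ge0 al.
have D1 : 1 <= D by rewrite /D; lra.
apply: (@counting_dim_ge1 _ _ D^-1); first by rewrite invr_gt0; lra.
move=> r; pose m := (Num.trunc `|r|).+1.
have /andP[_ rm] := truncn_itv (normr_ge0 r).
have [a Ha] := HS m.
pose t := lo - al * a%:R - `|al| * m%:R.
exists (if b then t else a%:R), (if b then a%:R else t), (D * m%:R); split.
  apply: le_trans (ler_norm r) _; apply: le_trans (ltW rm) _.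
  by rewrite -/m ler_peMl.
rewrite mulrA mulVf ?mul1r; last by rewrite gt_eqF//; lra.
apply: (@slanted_count_ge _ _ _ _ _ _ a) => // n p /andP[an nm] pn pt.
have anR : a%:R <= n%:R :> R by rewrite ler_nat.
have nmR : n%:R <= a%:R + m%:R :> R by rewrite -natrD ler_nat ltnW.
have m1 : 1 <= m%:R :> R by rewrite ler1n.
have aln : `|al * (n%:R - a%:R)| <= `|al| * m%:R.
  by rewrite normrM ler_wpM2l// ger0_norm; lra.
have Dm : D * m%:R = 2 * (`|al| * m%:R) + m%:R by rewrite /D; ring.
have alm : 0 <= `|al| * m%:R by rewrite mulr_ge0.
have Hl : a%:R <= longc b p <= a%:R + D * m%:R by rewrite pn; lra.
have Ht : t <= transc b p <= t + D * m%:R.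
  by move: aln; rewrite ler_norml mulrBr /t; lra.
by move: Hl Ht; rewrite /square /longc /transc; case: (b) => ? ?;
  split; rewrite /= in_itv.
Qed.

Lemma slanted_setT_mass_dim b al lo hi : lo + 1 <= hi ->
  mass_dim (slanted b al lo hi setT) = 1%E.
Proof.
move=> lohi; have [c c0 Hc] := slanted_square_le b al lo hi setT.
apply/eqP; rewrite eq_le (dims_le1 c0 Hc).2/=.
(* Over [0 <= n < m] the slice stays within [|al| * m + |lo| + 1 <= D * m] of the long axis. *)
pose D : R := `|al| + `|lo| + 1.
have al0 := normr_ge0 al; have lo0 := normr_ge0 lo.
have D1 : 1 <= D by rewrite /D; lra.
apply: (@mass_dim_ge1 _ _ D^-1); first by rewrite invr_gt0; lra.
move=> r; pose m := (Num.trunc `|r|).+1.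
have /andP[_ rm] := truncn_itv (normr_ge0 r).
exists (D * m%:R).
  apply: le_trans (ler_norm r) _; apply: le_trans (ltW rm) _.
  by rewrite -/m ler_peMl.
rewrite mulrA mulVf ?mul1r; last by rewrite gt_eqF//; lra.
apply: (@slanted_count_ge _ _ _ _ _ _ 0) => // n p.
rewrite add0n => /andP[_ nm] pn pt.
have n0 : 0 <= n%:R :> R by rewrite ler0n.
have nmR : n%:R <= m%:R :> R by rewrite ler_nat ltnW.
have m1 : 1 <= m%:R :> R by rewrite ler1n.
have aln : `|al * n%:R| <= `|al| * m%:R by rewrite normrM ler_wpM2l// ger0_norm.
have lom : `|lo| <= `|lo| * m%:R by rewrite ler_peMr.
have Dm : D * m%:R = `|al| * m%:R + `|lo| * m%:R + m%:R by rewrite /D; ring.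
have alm : 0 <= `|al| * m%:R by rewrite mulr_ge0.
have Hl : - (D * m%:R) <= longc b p <= - (D * m%:R) + 2 * (D * m%:R).
  by rewrite pn; lra.
have Ht : - (D * m%:R) <= transc b p <= - (D * m%:R) + 2 * (D * m%:R).
  move: aln; have := ler_norm lo; have := ler_norm (- lo).
  by rewrite normrN ler_norml; lra.
by move: Hl Ht; rewrite /square /longc /transc; case: (b) => ? ?;
  split; rewrite /= in_itv.
Qed.

(** * The sparse set with long runs *)

Definition dyadic_blocks : set nat :=
  [set n | exists k j, (j <= k)%N /\ n = (2 ^ k + j)%N].

Lemma dyadic_blocks_runs m : exists a,
  forall i, (i < m)%N -> dyadic_blocks (a + i).
Proof. by exists (2 ^ m)%N => i im; exists m, i; rewrite ltnW. Qed.

(** An element [2 ^ k + j] inside the window has [j <= k < M] with [M] of order [ln (2 * l)], so at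
    most [M ^ 2] long coordinates occur. *)
Lemma slanted_dyadic_mass_dim b al lo hi : lo + 1 <= hi ->
  mass_dim (slanted b al lo hi dyadic_blocks) = 0%E.
Proof.
move=> lohi; pose w := (Num.trunc `|hi - lo|).+1.
have low : hi - lo <= w%:R.
  apply: le_trans (ler_norm _) (ltW _).
  by have /andP[] := truncn_itv (normr_ge0 (hi - lo)).
have ln2 : 2^-1 <= ln 2 :> R.
  have : ln (1 + (- 2^-1)) <= - 2^-1 :> R by apply: le_ln1Dx; lra.
  by rewrite (_ : 1 + - 2^-1 = 2^-1 :> R); [rewrite lnV ?posrE//; lra | field].
(* Below, [M <= 2 * t + 1 <= 4 * t] since [t >= 1/2]; squaring gives the 16. Nonemptiness comes from
   the element [1 = 2 ^ 0 + 0]. *)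
apply: (@mass_dim_eq0 _ _ (16 * w.+2%:R)); first by rewrite mulr_gt0.
  have H : (1%:R%:E <= counting (slanted b al lo hi dyadic_blocks `&` setT) :> \bar R)%E.
    by apply: (@slanted_count_ge _ _ _ _ _ _ 1) => // -[_|//]; exists 0%N, 0%N.
  apply/set0P/negP => /eqP E0; move: H; rewrite setIT E0 => H.
  have := le_trans H (@counting_le_size R _ set0 [::] (@sub0set _ _)).
  by rewrite lee_fin ler10.
move=> l l1; set t := ln (2 * l).
have t12 : 2^-1 <= t.
  by apply: le_trans ln2 _; rewrite ler_ln ?posrE; lra.
(* From [2 ^ k <= 2 * l] and [ln 2 >= 1/2] follows [k <= 2 * t < M]. *)
pose M := (Num.trunc (2 * t)).+1.
have /andP[Mt tM] : (M.-1%:R <= 2 * t < M%:R) by apply: truncn_itv; lra.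
pose ns := [seq (2 ^ k + j)%:R : R | k <- iota 0 M, j <- iota 0 M].
have H := @slanted_count_le b al lo hi dyadic_blocks
  (slanted b al lo hi dyadic_blocks `&` square (- l) (- l) (2 * l)) ns w low.
apply: le_trans (H _ _) _; first exact: subIsetl.
- move=> p [[[n [k [j [jk ->]]] pn] _ _] []]; rewrite /= !in_itv /= => p1 p2.
  have kl : (2 ^+ k : R) <= 2 * l.
    apply: (@le_trans _ _ (longc b p)).
      by rewrite pn natrD natrX lerDl.
    by rewrite /longc; case: (b); lra.
  have kM : (k < M)%N.
    rewrite -(ltr_nat R); apply: le_lt_trans tM.
    have : ln (2 ^+ k) <= t by rewrite ler_ln ?posrE ?exprn_gt0//; lra.
    rewrite (@lnXn _ k 2)// -[ln _ *+ k]mulr_natr => kt.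
    have : 2^-1 * k%:R <= ln 2 * k%:R :> R by rewrite ler_wpM2r.
    by lra.
  rewrite pn; apply/allpairsP; exists (k, j).
  by split; rewrite // mem_iota add0n//; exact: leq_ltn_trans kM.
rewrite lee_fin /ns size_allpairs !size_iota natrM.
rewrite [leRHS](_ : _ = (4 * t) ^+ 2 * w.+2%:R); last by ring.
have ME : (M%:R : R) = M.-1%:R + 1 by rewrite -natr1.
by rewrite ler_wpM2r// natrM -expr2 lerXn2r ?nnegrE//; lra.
Qed.

End Slanted.

(** * Tubes as strips, and the two examples *)

(** For [u != 0] take [al = 1 / u] and [s = sqrt (1 + 1 / u ^ 2)]; for [u = 0] swap the axes. These
    depend on [u] alone, so one wide strip serves every [v], and each tube cuts out a narrower
    one. *)
Lemma tube_slanted (R : realType) (u : R) : exists b al (s : R), 1 <= s /\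
  forall v (S : set nat) (e : R), - e < v < e ->
    slanted b al (- e * s) ((e + 1) * s) S `&` tube u v =
    slanted b al (v * s) ((v + 1) * s) S.
Proof.
suff [b [al [s [s1 H]]]] : exists b al (s : R), 1 <= s /\
    forall v p, tube u v p <-> v * s < transc b p + al * longc b p <= (v + 1) * s.
  exists b, al, s; split => // v S e /andP[ev ve]; apply/seteqP; split => p.
    by case=> -[pS pi _] /H.
  move=> [pS pi pv]; split; last exact/H.
  split=> //; have : - e * s <= v * s by rewrite ler_wpM2r//; lra.
  have : (v + 1) * s <= (e + 1) * s by rewrite ler_wpM2r//; lra.
  by lra.
have [->|u0] := eqVneq u 0.
  exists true, 0, 1; split => // v p.
  by rewrite /tube eqxx /= !mulr1 mul0r addr0.
exists false, (1 / u), (Num.sqrt (1 + 1 / u ^+ 2)); split.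
  rewrite -[leLHS]sqrtr1 ler_wsqrtr// lerDl divr_ge0// sqr_ge0//.
move=> v p; rewrite /tube (negbTE u0) /= /longc /transc.
by split => ?; lra.
Qed.

Theorem theorem3 (R : realType) :
  (forall eps u0 : R, 0 < eps ->
     exists E : set (R * R), E `<=` @integer_lattice R /\
       forall v : R, - eps < v < eps ->
         [/\ mass_dim (E `&` tube u0 v) = 1%E,
             counting_dim (E `&` tube u0 v) = 1%E,
             counting_dim E = 1%E &
             mass_dim E = 1%E])
  /\
  (forall eps u0 : R, 0 < eps ->
     exists E : set (R * R), E `<=` @integer_lattice R /\
       forall v : R, - eps < v < eps ->
         (counting_dim (E `&` tube u0 v) = 1%E /\ counting_dim E = 1%E) /\
         (mass_dim (E `&` tube u0 v) = 0%E /\ mass_dim E = 0%E)).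
Proof.
(* Since [1 <= s], both strips contain the unit slice that the lower bounds count. *)
have wide (e s v : R) : 0 < e -> 1 <= s ->
    v * s + 1 <= (v + 1) * s /\ - e * s + 1 <= (e + 1) * s.
  move=> e0 s1; split; first by rewrite mulrDl mul1r lerD2l.
  by rewrite mulrDl mulNr mul1r; have := mulr_ge0 (ltW e0) (le_trans ler01 s1); lra.
split=> e u e0; have [b [al [s [s1 tubeE]]]] := tube_slanted u.
- exists (slanted b al (- e * s) ((e + 1) * s) setT).
  split=> [|v ve]; first exact: slanted_int.
  have [hv he] := wide e s v e0 s1; rewrite tubeE//.
  by split; rewrite ?slanted_setT_mass_dim// slanted_counting_dim//; exists 0%N.
- exists (slanted b al (- e * s) ((e + 1) * s) dyadic_blocks).
  split=> [|v ve]; first exact: slanted_int.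
  have [hv he] := wide e s v e0 s1; rewrite tubeE//.
  by split; split; rewrite ?slanted_dyadic_mass_dim// slanted_counting_dim//;
    exact: dyadic_blocks_runs.
Qed.
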